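(* Let $\mathcal T=[\mathbf A,\mathbf B,\mathbf C]_R$ with $\mathbf A\in\mathbb F^{I\times R}$, $\mathbf B\in\mathbb F^{J\times R}$, $\mathbf C\in\mathbb F^{K\times R}$, and let $m_{\mathbf C}:=R-r_{\mathbf C}+2$. Assume that (i) $\max\bigl(\min(k_{\mathbf A},k_{\mathbf B}-1),\ \min(k_{\mathbf A}-1,k_{\mathbf B})\bigr)+k_{\mathbf C}\ge R+1$; (ii) $\mathcal C_{m_{\mathbf C}}(\mathbf A)\odot\mathcal C_{m_{\mathbf C}}(\mathbf B)$ has full column rank. Then $r_{\mathcal T}=R$ and the CPD of $\mathcal T$ is unique.
   Context: $\mathbb F$ is $\mathbb R$ or $\mathbb C$. For matrices $\mathbf A,\mathbf B,\mathbf C$ with $R$ nonzero columns each, $[\mathbf A,\mathbf B,\mathbf C]_R:=\sum_{r=1}^R\mathbf a_r\circ\mathbf b_r\circ\mathbf c_r$ ($\circ$ = outer product). The rank $r_{\mathcal T}$ of a tensor is the minimal number of terms in such a representation; a representation with $R=r_{\mathcal T}$ terms is a canonical polyadic decomposition (CPD). The CPD of a tensor $\mathcal T$ of rank $R$ is unique if $\mathcal T=[\mathbf A,\mathbf B,\mathbf C]_R=[\bar{\mathbf A},\bar{\mathbf B},\bar{\mathbf C}]_R$ implies that there are an $R\times R$ permutation matrix $\mathbf\Pi$ and nonsingular diagonal matrices $\mathbf\Lambda_{\mathbf A},\mathbf\Lambda_{\mathbf B},\mathbf\Lambda_{\mathbf C}$ with $\bar{\mathbf A}=\mathbf A\mathbf\Pi\mathbf\Lambda_{\mathbf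 A}$, $\bar{\mathbf B}=\mathbf B\mathbf\Pi\mathbf\Lambda_{\mathbf B}$, $\bar{\mathbf C}=\mathbf C\mathbf\Pi\mathbf\Lambda_{\mathbf C}$, $\mathbf\Lambda_{\mathbf A}\mathbf\Lambda_{\mathbf B}\mathbf\Lambda_{\mathbf C}=\mathbf I_R$. $r_{\mathbf M}$ is the rank of a matrix $\mathbf M$; its $k$-rank $k_{\mathbf M}$ is the largest $k$ such that every set of $k$ columns of $\mathbf M$ is linearly independent. $\odot$ is the Khatri-Rao (column-wise Kronecker) product. For $\mathbf M\in\mathbb F^{p\times R}$ the $k$-th compound matrix $\mathcal C_k(\mathbf M)$ is the $\binom pk\times\binom Rk$ matrix of all $k\times k$ minors of $\mathbf M$, with row and column index sets ordered lexicographically; it is defined for $k\le\min(p,R)$, and a hypothesis involving compound matrices is understood to include that they are defined. *)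

(* Defs.v *)
From mathcomp Require Import all_boot all_order all_fingroup all_algebra.
From mathcomp Require Import boolp reals.
From mathcomp Require Export complex mxtens.

Set Implicit Arguments.
Unset Strict Implicit.
Unset Printing Implicit Defensive.

Import Order.TTheory GRing.Theory Num.Theory.
Local Open Scope ring_scope.

Notation tensor F I J K := {ffun 'I_I * 'I_J * 'I_K -> F}.

Definition outer (F : fieldType) (I J K : nat)
    (a : 'cV[F]_I) (b : 'cV[F]_J) (c : 'cV[F]_K) : tensor F I J K :=
  [ffun x => a x.1.1 0 * b x.1.2 0 * c x.2 0].

Definition nonzero_cols (F : fieldType) (p n : nat) (M : 'M[F]_(p, n)) : Prop :=
  forall r, col r M != 0.

Definition is_decomp (F : fieldType) (I J K n : nat) (T : tensor F I J K)
    (A : 'M[F]_(I, n)) (B : 'M[F]_(J, n)) (C : 'M[F]_(K, n)) : Prop :=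
  [/\ nonzero_cols A, nonzero_cols B, nonzero_cols C &
      T = \sum_(r < n) outer (col r A) (col r B) (col r C)].

Definition has_decomp (F : fieldType) (I J K : nat) (T : tensor F I J K)
    (n : nat) : Prop :=
  exists (A : 'M[F]_(I, n)) (B : 'M[F]_(J, n)) (C : 'M[F]_(K, n)),
    is_decomp T A B C.

Lemma ex_decomp (F : fieldType) (I J K : nat) (T : tensor F I J K) :
  exists n, `[< has_decomp T n >].
Proof.
pose S := [set x | T x != 0]; exists #|S|; apply/asboolP.
pose e (r : 'I_#|S|) := enum_val r.
have eS r : T (e r) != 0 by have := enum_valP r; rewrite inE.
exists (\matrix_(i, r) (T (e r) *+ (i == (e r).1.1))),
  (\matrix_(j, r) (j == (e r).1.2)%:R), (\matrix_(k, r) (k == (e r).2)%:R).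
split=> [r|r|r|].
- by apply/eqP => /matrixP/(_ (e r).1.1 0)/eqP; rewrite !mxE eqxx (negPf (eS r)).
- by apply/eqP => /matrixP/(_ (e r).1.2 0)/eqP; rewrite !mxE eqxx oner_eq0.
- by apply/eqP => /matrixP/(_ (e r).2 0)/eqP; rewrite !mxE eqxx oner_eq0.
apply/ffunP => x; rewrite sum_ffunE.
transitivity (\sum_(y in S) (T y *+ (x == y))).
  have [xS|] := boolP (x \in S).
    rewrite (bigD1 x) //= eqxx big1 ?addr0 // => y /andP[_ /negPf yx].
    by rewrite [x == y]eq_sym yx.
  rewrite inE negbK => /eqP Tx0; rewrite Tx0 big1 // => y _.
  by case: (eqVneq x y) => [<-|//]; rewrite Tx0.
rewrite big_enum_val; apply: eq_bigr => r _; rewrite !ffunE !mxE -/(e r).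
case: x (e r) => [[i j] k] [[i' j'] k'] /=; rewrite !xpair_eqE.
by do 3 case: eqP => _ /=; rewrite ?mulr1 ?mulr0 ?mul0r.
Qed.

Definition tensor_rank (F : fieldType) (I J K : nat) (T : tensor F I J K) : nat :=
  ex_minn (ex_decomp T).

Definition nonsingular_diag (F : fieldType) (n : nat) (L : 'M[F]_n) : bool :=
  is_diag_mx L && (L \in unitmx).

Definition cpd_unique (F : fieldType) (I J K : nat) (T : tensor F I J K) : Prop :=
  let n := tensor_rank T in
  forall (A A' : 'M[F]_(I, n)) (B B' : 'M[F]_(J, n)) (C C' : 'M[F]_(K, n)),
    is_decomp T A B C -> is_decomp T A' B' C' ->
    exists P LA LB LC : 'M[F]_n,
      [/\ is_perm_mx P,
          [/\ nonsingular_diag LA, nonsingular_diag LB & nonsingular_diag LC],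
          [/\ A' = A *m P *m LA, B' = B *m P *m LB & C' = C *m P *m LC]
        & LA *m LB *m LC = 1%:M].

(* The bound [k < n.+1] matters: the independence condition holds vacuously
   for every [k] exceeding the number [n] of columns. *)
Definition krank (F : fieldType) (p n : nat) (M : 'M[F]_(p, n)) : nat :=
  \max_(k < n.+1 | [forall S : {set 'I_n},
                     (#|S| == k) ==> free [seq col j M | j <- enum S]]) k.

(* k-subsets of 'I_p are encoded by strictly increasing k-tuples. *)
Definition inc_tuples (p k : nat) : seq (k.-tuple 'I_p) :=
  sort (fun s t : k.-tuplelexi 'I_p => (s <= t)%O)
    (enum [set t : k.-tuple 'I_p | sorted ltn (map val t)]).

Lemma size_inc_tuples (p k : nat) : size (inc_tuples p k) == 'C(p, k).
Proof. by rewrite size_sort -cardE card_ltn_sorted_tuples. Qed.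

Definition lex_subsets (p k : nat) : 'C(p, k).-tuple (k.-tuple 'I_p) :=
  Tuple (size_inc_tuples p k).

Definition compound (F : fieldType) (p n k : nat) (M : 'M[F]_(p, n)) :
    'M[F]_('C(p, k), 'C(n, k)) :=
  \matrix_(i, j) \det (mxsub (tnth (tnth (lex_subsets p k) i))
                             (tnth (tnth (lex_subsets n k) j)) M).

Definition khatri_rao (F : fieldType) (p q n : nat)
    (A : 'M[F]_(p, n)) (B : 'M[F]_(q, n)) : 'M[F]_(p * q, n) :=
  \matrix_(i, r) (tensmx (col r A) (col r B)) i ord0.

(* Main.v *)
Require Import Defs.
From mathcomp Require Import all_boot all_order all_fingroup all_algebra.
From mathcomp Require Import boolp reals complex zify ring.

Set Implicit Arguments.
Unset Strict Implicit.
Unset Printing Implicit Defensive.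

Import Order.TTheory GRing.Theory Num.Theory.
Local Open Scope ring_scope.

(** Write [m = R - rank C + 2] and, for a weight vector [d], let [w d] be the
    number of nonzero entries of [d].  By the Cauchy-Binet formula the entries
    of [C_m(A diag(d) B^T)] are those of the Khatri-Rao product
    [C_m(A) (.) C_m(B)] applied to the vector of [m]-fold products of entries
    of [d]; hence condition (ii) gives [rank (A diag(d) B^T) >= min(w d, m)].
    Contracting [T] along a functional [x] of the third mode, any decomposition
    [[A', B', C']] with [R' <= R] terms thus satisfies
    [min(w(x C), m) <= w(x C')], and Kruskal's permutation lemma yields
    [R' = R] and [C' = C] up to permutation and scaling.

    Once [C' = C], choose [x] vanishing on [k_C - 1] columns of [C]: the
    remaining [R - k_C + 1] columns of [B'] lie in the span of the corresponding
    columns of [B].  Intersecting these spans, which is possible since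
    [k_B >= R - k_C + 2] (or symmetrically for [A]), shows that each column of
    [B'] is a multiple of that of [B], and then likewise for [A']. *)

(** * The rank bound from condition (ii) *)

(** Distributing the product over the entry sums in the Leibniz formula chooses a column [f i] for
    each row; repeated choices are still allowed. *)
Lemma det_mulmx_ffun (R : comPzRingType) (m n : nat)
    (A : 'M[R]_(m, n)) (B : 'M[R]_(n, m)) :
  \det (A *m B) =
    \sum_(f : {ffun 'I_m -> 'I_n}) \det (rowsub f B) * \prod_i A i (f i).
Proof.
transitivity (\sum_(f : {ffun 'I_m -> 'I_n}) \sum_(s : 'S_m)
    (-1) ^+ s * \prod_i (A i (f i) * B (f i) (s i))).
  rewrite exchange_big; apply: eq_bigr => s _; rewrite -big_distrr /=.
  congr (_ * _).
  rewrite -(bigA_distr_bigA (fun i j => A i j * B j (s i))) /=.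
  by apply: eq_bigr => i _; rewrite mxE.
apply: eq_bigr => f _; rewrite mulrC big_distrr /=; apply: eq_bigr => s _.
rewrite big_split /= mulrCA; congr (_ * (_ * _)).
by apply: eq_bigr => i _; rewrite mxE.
Qed.

Lemma mem_inc_tuples (p k : nat) (t : k.-tuple 'I_p) :
  (t \in inc_tuples p k) = sorted ltn (map val t).
Proof. by rewrite mem_sort mem_enum inE. Qed.

Lemma inc_tuples_uniq (p k : nat) : uniq (inc_tuples p k).
Proof. by rewrite sort_uniq enum_uniq. Qed.

(** A non-injective [f] repeats a row of [B] and contributes 0. The injective ones are grouped by
    sorted image [t]; within a group [f] is [t] after a permutation, whose sign completes the minor
    of [A]. *)
Lemma cauchy_binet (R : comPzRingType) (m n : nat)
    (A : 'M[R]_(m, n)) (B : 'M[R]_(n, m)) :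
  \det (A *m B) = \sum_(t <- inc_tuples n m)
    \det (colsub (tnth t) A) * \det (rowsub (tnth t) B).
Proof.
rewrite det_mulmx_ffun (bigID (fun f : {ffun _} => injectiveb f)) /= addrC.
rewrite big1 ?add0r => [|f]; last first.
  case/injectivePn => i1 [i2 ne_i12 eq_f].
  by rewrite (determinant_alternate ne_i12) ?mul0r // => j; rewrite !mxE eq_f.
pose le_ord (i j : 'I_n) := (i <= j)%N.
have le_tot : total le_ord by move=> i j; apply: leq_total.
have le_tr : transitive le_ord by move=> j i k; apply: leq_trans.
have le_anti : antisymmetric le_ord.
  by move=> i j ij; apply/val_inj/anti_leq.
pose img (f : {ffun 'I_m -> 'I_n}) : m.-tuple 'I_n :=
  [tuple of sort le_ord (map_tuple f (ord_tuple m))].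
have mem_img f i : (i \in img f) = (i \in codom f).
  by rewrite mem_sort; congr (_ \in map _ _); exact: val_ord_tuple.
have sorted_img f : sorted le_ord (img f) by exact: sort_sorted.
have inc_img (f : {ffun _}) : injectiveb f -> img f \in inc_tuples n m.
  move=> /injectiveP inj_f; rewrite mem_inc_tuples ltn_sorted_uniq_leq.
  rewrite (map_inj_uniq val_inj) sorted_map sort_uniq sorted_img andbT /=.
  by rewrite (map_inj_uniq inj_f); exact: enum_uniq.
rewrite big_uniq ?inc_tuples_uniq //=.
rewrite (partition_big img (mem (inc_tuples n m))) //=; apply: eq_bigr => t.
rewrite mem_inc_tuples ltn_sorted_uniq_leq (map_inj_uniq val_inj) sorted_map.
case/andP=> uniq_t sorted_t.
have inj_t : injective (tnth t) by apply/tuple_uniqP.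
pose h (s : 'S_m) : {ffun 'I_m -> 'I_n} := [ffun i => tnth t (s i)].
(* Inverse of [h] on the injective [f] with sorted image [t]; there the defaults [1] and [i] are
   never reached. *)
pose h' (f : {ffun 'I_m -> 'I_n}) : 'S_m :=
  insubd (1%g : 'S_m) [ffun i => odflt i [pick j | tnth t j == f i]].
have hK s : h' (h s) = s.
  apply: val_inj; rewrite val_insubd.
  have -> : [ffun i => odflt i [pick j | tnth t j == h s i]] = pval s.
    apply/ffunP=> i; rewrite !ffunE -pvalE; case: pickP => [j|no] /=.
      by rewrite ?ffunE => /eqP/inj_t.
    by have:= no (s i); rewrite /= pvalE eqxx.
  by rewrite (valP s).
rewrite (reindex_onto h h') /= => [|f /andP[/injectiveP inj_f /eqP img_f]].
  have imgh s : injectiveb (h s) && (img (h s) == t) && (h' (h s) == s).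
    have inj_h : injective (h s).
      by move=> i j; rewrite !ffunE => /inj_t/perm_inj.
    rewrite hK eqxx andbT; apply/andP; split; first exact/injectiveP.
    apply/eqP/val_inj/(sorted_eq le_tr le_anti) => //; first exact: sorted_img.
        apply: uniq_perm => // [|i].
      by have:= inc_img _ (introT (injectiveP _) inj_h);
        rewrite mem_inc_tuples ltn_sorted_uniq_leq (map_inj_uniq val_inj)
        => /andP[].
    rewrite mem_img; apply/codomP/tnthP => [[j ->]|[j ->]].
      by exists (s j); rewrite ffunE.
    by exists (s^-1 j)%g; rewrite ffunE permKV.
  rewrite (eq_bigl _ _ imgh) big_distrl; apply: eq_bigr => s _ /=.
  have -> : rowsub (h s) B = row_perm s (rowsub (tnth t) B).
    by apply/matrixP => i j; rewrite !mxE ffunE.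
  rewrite row_permE det_mulmx det_perm mulrAC; congr (_ * _ * _).
  by apply: eq_bigr => i _; rewrite !mxE ffunE.
apply/ffunP => i; rewrite ffunE.
have f_t j : exists k, tnth t k = f j.
  have: f j \in img f by rewrite mem_img codom_f.
  by rewrite img_f => /tnthP[k ->]; exists k.
have pick_f j : tnth t (odflt j [pick k | tnth t k == f j]) = f j.
  case: pickP => [k /eqP//|no]; have [k ek] := f_t j.
  by have:= no k; rewrite ek eqxx.
rewrite -pvalE val_insubd; case: ifP => [_|]; first by rewrite ffunE pick_f.
case/negP; apply/injectiveP => j k; rewrite !ffunE => eq_jk.
by apply: inj_f; rewrite -pick_f eq_jk pick_f.
Qed.

(** * Ranks of submatrices, sums and diagonal matrices *)

Lemma mxrank_mxsub (F : fieldType) (m n m' n' : nat) (f : 'I_m' -> 'I_m)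
    (g : 'I_n' -> 'I_n) (M : 'M[F]_(m, n)) :
  (\rank (mxsub f g M) <= \rank M)%N.
Proof.
rewrite mxsubrc (leq_trans (mxrankS (rowsub_sub _ _))) //.
by rewrite -mxrank_tr trmx_mxsub -[leqRHS]mxrank_tr mxrankS ?rowsub_sub.
Qed.

Lemma det_eq0_rank (F : fieldType) (m : nat) (M : 'M[F]_m) :
  (\rank M < m)%N -> \det M = 0.
Proof.
apply: contraTeq => det_neq0.
by rewrite -leqNgt mxrank_unit // unitmxE unitfE.
Qed.

Lemma mxrank_sum (F : fieldType) (m n : nat) (I : finType) (P : pred I)
    (M : I -> 'M[F]_(m, n)) :
  (\rank (\sum_(i | P i) M i)%R <= \sum_(i | P i) \rank (M i))%N.
Proof.
apply: (big_ind2 (fun M k => \rank M <= k)%N) => // [|M1 k1 M2 k2 le1 le2].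
  by rewrite mxrank0.
exact: leq_trans (mxrank_add _ _) (leq_add le1 le2).
Qed.

Definition supp (F : fieldType) (n : nat) (d : 'rV[F]_n) : {set 'I_n} :=
  [set i | d 0 i != 0].

Lemma mxrank_diag_le (F : fieldType) (n : nat) (d : 'rV[F]_n) :
  (\rank (diag_mx d) <= #|supp d|)%N.
Proof.
rewrite diag_mx_sum_delta (bigID (mem (supp d))) /= addrC big1 => [|i];
  last first.
  by rewrite inE negbK => /eqP->; rewrite scale0r.
rewrite add0r (leq_trans (mxrank_sum _ _)) // -sum1_card leq_sum // => i _.
by rewrite (leq_trans (mxrank_scale _ _)) // mxrank_delta.
Qed.

Lemma subset_of_card (T : finType) (S : {set T}) (k : nat) :
  (k <= #|S|)%N -> exists2 U : {set T}, U \subset S & #|U| = k.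
Proof.
move=> le_kS; exists [set x in take k (enum S)].
  by apply/subsetP=> x; rewrite inE => /mem_take; rewrite mem_enum.
rewrite cardsE (card_uniqP _) ?take_uniq ?enum_uniq // size_take -cardE.
by case: ltngtP le_kS.
Qed.

Lemma inc_tuple_of_set (n m : nat) (S : {set 'I_n}) :
  (m <= #|S|)%N ->
  exists2 t, t \in inc_tuples n m & forall i, tnth t i \in S.
Proof.
case/subset_of_card=> U /subsetP sUS cardU.
have sizeU : size (enum U) == m by rewrite -cardE cardU.
exists (Tuple sizeU) => [|i]; last first.
  by apply: sUS; rewrite -mem_enum; exact: (mem_tnth i (Tuple sizeU)).
rewrite mem_inc_tuples sorted_map /= /enum_mem -enumT sorted_filter //.
  by move=> j i k; apply: ltn_trans.
by rewrite -sorted_map val_enum_ord iota_ltn_sorted.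
Qed.

Lemma big_inc_tuples (V : nmodType) (n m : nat) (G : m.-tuple 'I_n -> V) :
  \sum_(t <- inc_tuples n m) G t = \sum_j G (tnth (lex_subsets n m) j).
Proof. by rewrite -(big_tuple _ _ (lex_subsets n m) predT G). Qed.

Section RankBound.
Variables (F : fieldType) (I J R m : nat).
Variables (A : 'M[F]_(I, R)) (B : 'M[F]_(J, R)).
Hypothesis full : \rank (khatri_rao (compound m A) (compound m B)) = 'C(R, m).

(** All [m]-minors of the weighted product vanish. By Cauchy-Binet they are the entries of the
    Khatri-Rao matrix times the vector [v] of [m]-fold products, so full column rank gives
    [v = 0]. *)
Lemma prod_eq0_of_rank (d : 'rV[F]_R) (t : m.-tuple 'I_R) :
    (\rank (A *m diag_mx d *m B^T) < m)%N -> t \in inc_tuples R m ->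
  \prod_i d 0 (tnth t i) = 0.
Proof.
move=> rk_lt; have {rk_lt} minor0 (f : m.-tuple _) (g : m.-tuple _) :
    \det (mxsub (tnth f) (tnth g) (A *m diag_mx d *m B^T)) = 0 :> F.
  by apply: det_eq0_rank; apply: leq_ltn_trans (mxrank_mxsub _ _ _) rk_lt.
pose v : 'cV_('C(R, m)) :=
  \col_j \prod_i d 0 (tnth (tnth (lex_subsets R m) j) i).
suff v0 : v = 0.
  case/(tnthP (lex_subsets R m)) => j ->.
  by have/matrixP/(_ j 0) := v0; rewrite !mxE.
apply: trmx_inj; rewrite trmx0; apply/eqP.
rewrite -(mulmx_free_eq0 _ (B := (khatri_rao (compound m A) (compound m B))^T)).
  rewrite -trmx_mul -trmx0 (inj_eq trmx_inj); apply/eqP/matrixP => k l.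
  rewrite {l}ord1; case: (mxtens_indexP k) => i j.
  have := minor0 (tnth (lex_subsets I m) i) (tnth (lex_subsets J m) j).
  rewrite mxsub_mul cauchy_binet big_inc_tuples => minor0_ij.
  rewrite [RHS]mxE -minor0_ij mxE; apply: eq_bigr => r _.
  rewrite [khatri_rao _ _ _ _]mxE !mxE mxtens_indexK /=.
  set s := tnth (tnth (lex_subsets R m) r).
  have -> : rowsub s (colsub (tnth (tnth (lex_subsets J m) j)) B^T) =
      (mxsub (tnth (tnth (lex_subsets J m) j)) s B)^T.
    by apply/matrixP => a b; rewrite !mxE.
  rewrite det_tr -mxsubcr mulrAC; congr (_ * _).
  have -> : mxsub (tnth (tnth (lex_subsets I m) i)) s (A *m diag_mx d) =
      mxsub (tnth (tnth (lex_subsets I m) i)) s A *m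
        diag_mx (\row_k d 0 (s k)).
    by rewrite !mul_mx_diag; apply/matrixP => a b; rewrite !mxE.
  rewrite det_mulmx det_diag; congr (_ * _).
  by apply: eq_bigr => l _; rewrite mxE.
by rewrite -row_leq_rank mxrank_tr full.
Qed.

(* When [supp d] has fewer than [m] elements, enlarge it to [m] elements by a
   diagonal matrix whose rank is the number of added elements. *)
Lemma rank_weighted_ge (d : 'rV[F]_R) : (m <= R)%N ->
  (minn #|supp d| m <= \rank (A *m diag_mx d *m B^T))%N.
Proof.
move=> le_mR.
have rank_ge_m e : (m <= #|supp e|)%N -> (m <= \rank (A *m diag_mx e *m B^T))%N.
  case/inc_tuple_of_set => t tR t_supp; rewrite leqNgt; apply/negP.
  move/prod_eq0_of_rank => /(_ t tR)/eqP; rewrite prodf_seq_eq0 => /hasP[i _].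
  by have:= t_supp i; rewrite inE => /negP.
have [/rank_ge_m // | lt_m] := leqP m #|supp d|.
have [|U /subsetP U_supp cardU] :=
    @subset_of_card _ (~: supp d) (m - #|supp d|).
  by rewrite [#|~: _|]cardsCs setCK card_ord leq_sub2r.
pose e : 'rV[F]_R := \row_i (i \in U)%:R.
have supp_e : supp e = U.
  by apply/setP=> i; rewrite !inE mxE; case: (i \in U); rewrite ?oner_eq0 ?eqxx.
have supp_de : supp (d + e) = supp d :|: U.
  apply/setP=> i; rewrite !inE !mxE.
  have [iU|_] := boolP (i \in U); last by rewrite addr0 orbF.
  have:= U_supp i iU; rewrite !inE negbK => /eqP->.
  by rewrite add0r oner_eq0 orbT.
have le_m_rank : (m <= \rank (A *m diag_mx (d + e) *m B^T))%N.
  apply: rank_ge_m; rewrite supp_de cardsU cardU.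
  have -> : supp d :&: U = set0.
    apply/setP=> i; rewrite [RHS]inE inE andbC.
    by have [/U_supp|] //= := boolP (i \in U); rewrite inE => /negPf.
  by rewrite cards0 subn0 subnKC // ltnW.
rewrite -(leq_add2r (m - #|supp d|)) subnKC ?(ltnW lt_m) //.
apply: leq_trans le_m_rank _; rewrite linearD /= mulmxDr mulmxDl.
apply: leq_trans (mxrank_add _ _) _; rewrite leq_add2l -cardU -supp_e.
apply: leq_trans (mxrank_diag_le e).
by apply: leq_trans (mxrankM_maxl _ _) _; apply: mxrankM_maxr.
Qed.

End RankBound.

(** * Kruskal's permutation lemma *)

(** Matroid exchange: [V + w] exceeds [V] by at most one dimension, which [u] already fills. *)
Lemma addsmx_exchange (F : fieldType) (n p : nat) (V : 'M[F]_(p, n))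
    (u w : 'rV[F]_n) :
  (u <= V + w)%MS -> ~~ (u <= V)%MS -> (V + u :=: V + w)%MS.
Proof.
move=> u_Vw u_V; have le_uw : (V + u <= V + w)%MS.
  by rewrite addsmx_sub addsmxSl u_Vw.
apply/eqmxP; rewrite le_uw /= -(geq_leqif (mxrank_leqif_sup le_uw)).
apply: leq_trans (mxrank_adds_leqif V w) _.
apply: leq_trans (leq_add (leqnn _) (rank_leq_row w)) _.
rewrite addn1 ltnNge (geq_leqif (mxrank_leqif_sup (addsmxSl V u))).
by rewrite addsmx_sub submx_refl.
Qed.

(** Some column [x] of the cokernel of [V] does not kill [D]. Then the kernel of [x] in [D] contains
    [V] and is a proper subspace, hence equals the hyperplane [V]. *)
Lemma exists_normal (F : fieldType) (n p q : nat) (V : 'M[F]_(p, n))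
    (D : 'M[F]_(q, n)) :
    (V <= D)%MS -> (\rank V).+1 = \rank D ->
  exists x : 'cV[F]_n, forall u : 'rV[F]_n,
    (u <= D)%MS -> (u <= V)%MS = (u *m x == 0).
Proof.
move=> VD rkV.
have /matrix0Pn[i [j ne0]] : D *m cokermx V != 0.
  rewrite -submxE; apply/negP=> /mxrankS; by rewrite -rkV ltnn.
pose x := col j (cokermx V); exists x => u uD.
have Vx : (V <= D :&: kermx x)%MS.
  rewrite sub_capmx VD; apply/sub_kermxP.
  by rewrite /x colE mulmxA mulmx_coker mul0mx.
have ltD : (\rank (D :&: kermx x)%MS < \rank D)%N.
  rewrite ltnNge (geq_leqif (mxrank_leqif_sup (capmxSl _ _))) sub_capmx.
  rewrite submx_refl sub_kermx; apply: contra ne0 => /eqP/matrixP/(_ i 0).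
  by rewrite /x colE mulmxA -colE !mxE => ->.
have le_Vx : (D :&: kermx x <= V)%MS.
  by rewrite -(geq_leqif (mxrank_leqif_sup Vx)) -ltnS rkV.
apply/idP/idP => [uV | /eqP ux0].
  by rewrite -sub_kermx; apply: submx_trans (submx_trans uV Vx) (capmxSr _ _).
by apply: submx_trans le_Vx; rewrite sub_capmx uD; apply/sub_kermxP.
Qed.

Section PermutationLemma.
Variables (F : fieldType) (K R R' : nat).
Variables (C : 'M[F]_(K, R)) (C' : 'M[F]_(K, R')).

Hypothesis cols_indep : forall (v : 'rV[F]_K) i1 i2,
  ((col i1 C)^T <= v)%MS -> ((col i2 C)^T <= v)%MS -> i1 = i2.
Hypothesis C_neq0 : nonzero_cols C.
Hypothesis C'_neq0 : nonzero_cols C'.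
Hypothesis le_R'R : (R' <= R)%N.
Hypothesis rank_gt1 : (1 < \rank C)%N.
Hypothesis supp_le : forall x : 'rV[F]_K,
  (minn #|supp (x *m C)| (R - \rank C + 2) <= #|supp (x *m C')|)%N.

Lemma in_supp_mulmx (n : nat) (M : 'M[F]_(K, n)) (x : 'rV[F]_K) i :
  (i \in supp (x *m M)) = ((col i M)^T *m x^T != 0).
Proof.
have -> : (col i M)^T *m x^T = ((x *m M) 0 i)%:M.
  apply/matrixP=> a b; rewrite !ord1 -trmx_mul colE mulmxA -colE !mxE.
  by rewrite mulr1n.
by rewrite inE -scalemx1 scalemx_eq0 (negPf (matrix_nonzero1 _ _)) orbF.
Qed.

Definition cols_in (n p : nat) (M : 'M[F]_(K, n)) (V : 'M[F]_(p, K)) :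
    {set 'I_n} :=
  [set i | ((col i M)^T <= V)%MS].

(** Subspaces are row spaces, hence the transpose; generated square matrices give all flats the same
    type. *)
Definition flat (S : {set 'I_R'}) : 'M[F]_K :=
  (\sum_(j in S) <<(col j C')^T>>)%MS.

Lemma flat_sub S : (flat S <= C'^T)%MS.
Proof.
by apply/sumsmx_subP => j _; rewrite genmxE tr_col row_sub.
Qed.

Lemma mem_flat (S : {set 'I_R'}) j : j \in S -> ((col j C')^T <= flat S)%MS.
Proof.
by move=> jS; rewrite -genmxE; apply: (sumsmx_sup j).
Qed.

Lemma flatU1 S j : (flat (j |: S) :=: flat S + (col j C')^T)%MS.
Proof.
apply/eqmxP/andP; split.
  apply/sumsmx_subP => i; rewrite in_setU1 => /predU1P[-> | iS].
    by rewrite genmxE addsmxSr.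
  by rewrite genmxE (submx_trans (mem_flat iS)) ?addsmxSl.
rewrite addsmx_sub mem_flat ?setU11 // andbT.
apply/sumsmx_subP => i iS.
by rewrite genmxE mem_flat // setU1r.
Qed.

Lemma rank_flat_le S : (\rank (flat S) <= #|S|)%N.
Proof.
rewrite -sum1_card; apply: (big_ind2 (fun V k => \rank V <= k)%N).
- by rewrite mxrank0.
- move=> V1 k1 V2 k2 le1 le2.
  exact: leq_trans (mxrank_adds_leqif _ _) (leq_add le1 le2).
by move=> j _; rewrite genmxE rank_leq_row.
Qed.

(** If [x] kills [C'], the right side of [supp_le] is 0. Since the second argument of the minimum is
    at least 2, [x] kills [C] too. *)
Lemma cols_sub : (C^T <= C'^T)%MS.
Proof.
rewrite submxE; apply/eqP/matrixP => i j.
pose x := (col j (cokermx C'^T))^T.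
have x0 : x *m C' = 0.
  apply: trmx_inj.
  by rewrite trmx_mul trmxK colE mulmxA mulmx_coker mul0mx trmx0.
have := supp_le x; rewrite x0.
have -> : supp (0 : 'rV[F]_R') = set0 by apply/setP => l; rewrite !inE mxE eqxx.
rewrite cards0 geq_min !leqn0 addn_eq0 andbF orbF cards_eq0.
move=> /eqP/setP/(_ i); rewrite in_supp_mulmx [RHS]inE => /negbFE.
rewrite /x trmxK => /eqP/matrixP/(_ 0 0).
by rewrite tr_col colE mulmxA -colE -row_mul !mxE => ->.
Qed.

Lemma tr_col_sub i : ((col i C)^T <= C'^T)%MS.
Proof. by rewrite tr_col (submx_trans (row_sub _ _)) ?cols_sub. Qed.

(** For a normal [x] of the hyperplane, the supports are the columns outside it. At least
    [\rank C' - 1] columns of [C'] lie inside, so [x^T *m C'] has weight at most [R - \rank C + 1],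
    and the minimum in [supp_le] must be the weight of [x^T *m C]. *)
Lemma card_cols_in_hyperplane S : (\rank (flat S)).+1 = \rank C' ->
  (R + #|cols_in C' (flat S)| <= R' + #|cols_in C (flat S)|)%N.
Proof.
move=> rkS.
have [|x normal] := exists_normal (flat_sub S); first by rewrite mxrank_tr.
have suppC : supp (x^T *m C) = ~: cols_in C (flat S).
  by apply/setP=> i; rewrite in_supp_mulmx trmxK !inE normal ?tr_col_sub.
have suppC' : supp (x^T *m C') = ~: cols_in C' (flat S).
  apply/setP=> i; rewrite in_supp_mulmx trmxK !inE normal //.
  by rewrite tr_col row_sub.
have := supp_le x^T; rewrite suppC suppC'.
have cardC := cardsC (cols_in C (flat S)).
have cardC' := cardsC (cols_in C' (flat S)).
have le_rank : (\rank C <= \rank C')%N.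
  by rewrite -(mxrank_tr C) -(mxrank_tr C') mxrankS ?cols_sub.
have le_S : (\rank (flat S) <= #|cols_in C' (flat S)|)%N.
  apply: leq_trans (rank_flat_le S) (subset_leq_card _).
  by apply/subsetP => j jS; rewrite inE mem_flat.
have := rank_leq_col C; have := rank_leq_col C'.
rewrite !card_ord in cardC cardC'.
lia.
Qed.

(* Downward induction on the dimension of the flat [V].  The flats of dimension
   one more that contain [V] partition the columns of [C'] outside [V], and are
   disjoint outside [V] also for the columns of [C].  Were the claim false for
   [V], each of these classes would contain strictly more columns of [C] than
   of [C'] by the same margin, and as there are at least two of them [C] would
   have too many columns. *)
Lemma card_cols_in_flat k S : (\rank (flat S) + k.+1 = \rank C')%N ->
  (R + #|cols_in C' (flat S)| <= R' + #|cols_in C (flat S)|)%N.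
Proof.
elim: k S => [|k IHk] S rkS.
  by apply: card_cols_in_hyperplane; rewrite -addn1.
set V := flat S; rewrite leqNgt; apply/negP => lt_V.
(* The flat [V + v] is labelled by the finite set of columns of [C'] in it. *)
pose g (v : 'rV[F]_K) := cols_in C' (V + v)%MS.
pose O' := ~: cols_in C' V; pose O := ~: cols_in C V.
pose g' j := g (col j C')^T; pose h i := g (col i C)^T.
have O'E j : (j \in O') = ~~ ((col j C')^T <= V)%MS by rewrite !inE.
have classes j : j \in O' ->
    (#|[set j' in O' | g' j' == g' j]| +
      (R + #|cols_in C' V| - (R' + #|cols_in C V|)) <=
    #|[set i in O | h i == g' j]|)%N.
  move=> jO'.
  have flatU := flatU1 S j.
  have rkU : (\rank (flat (j |: S)) = (\rank V).+1)%N.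
    rewrite flatU; apply/eqP; rewrite eqn_leq; apply/andP; split.
      apply: leq_trans (mxrank_adds_leqif _ _) _.
      by rewrite -[leqRHS]addn1 leq_add2l rank_leq_row.
    rewrite ltnNge (geq_leqif (mxrank_leqif_sup (addsmxSl V _))).
    by rewrite addsmx_sub submx_refl -O'E.
  have := IHk (j |: S); rewrite rkU addSnnS => /(_ rkS).
  have cols_inU n (M : 'M[F]_(K, n)) :
      cols_in M (flat (j |: S)) = cols_in M (V + (col j C')^T)%MS.
    by apply/setP=> i; rewrite !inE flatU.
  rewrite !cols_inU.
  have splitC n (M : 'M[F]_(K, n)) :
      #|cols_in M (V + (col j C')^T)%MS| = (#|cols_in M V| +
        #|[set i in ~: cols_in M V | g (col i M)^T == g' j]|)%N.
    rewrite -(cardsID (cols_in M V)).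
    congr (_ + _)%N; apply: eq_card => i; rewrite !inE.
      rewrite andbC; case: (boolP (_ <= V)%MS) => //= iV.
      by rewrite (submx_trans iV) ?addsmxSl.
    apply: andb_id2l => iV; apply/idP/eqP => [iU | gi].
      by apply/setP=> l; rewrite !inE (addsmx_exchange iU iV).
    have jj : j \in g' j by rewrite inE addsmxSr.
    have : j \in g (col i M)^T by rewrite gi.
    rewrite inE => ji; rewrite O'E in jO'.
    by rewrite (addsmx_exchange ji jO') addsmxSr.
  have := splitC _ C : _ = (_ + #|[set i in O | h i == g' j]|)%N.
  have := splitC _ C' : _ = (_ + #|[set j' in O' | g' j' == g' j]|)%N.
  lia.
pose Q := g' @: O'.
have sum_O' : #|O'| = (\sum_(q in Q) #|[set j in O' | g' j == q]|)%N.
  rewrite -sum1_card (partition_big g' (mem Q)) => [|j jO'];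
    last exact: imset_f.
  apply: eq_bigr => q _; rewrite -sum1_card.
  by apply: eq_bigl => j; rewrite inE.
have sum_O : (\sum_(q in Q) #|[set i in O | h i == q]| <= #|O|)%N.
  rewrite -[leqRHS]sum1_card (partition_big h predT) //=.
  rewrite [leqRHS](bigID (mem Q)) /=.
  apply: leq_trans (leq_addr _ _); apply: eq_leq.
  apply: eq_bigr => q _; rewrite -sum1_card.
  by apply: eq_bigl => j; rewrite inE.
have out p (W : 'M[F]_(p, K)) : (\rank W < \rank C')%N ->
    exists j, ~~ ((col j C')^T <= W)%MS.
  move=> ltW; apply/existsP; rewrite -negb_forall.
  apply: contraL ltW => /forallP sub.
  rewrite -leqNgt -(mxrank_tr C') mxrankS //; apply/row_subP => j.
  by rewrite -tr_col; apply: sub.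
(* [V] has codimension at least two, so two columns of [C'] chosen in succession span distinct flats
   over [V]. *)
have [|j jV] := out _ V; first by rewrite -rkS -[ltnLHS]addn0 ltn_add2l.
have [|j' j'V] := out _ (V + (col j C')^T)%MS.
  rewrite -rkS; apply: leq_ltn_trans (mxrank_adds_leqif _ _) _.
  by rewrite ltn_add2l (leq_ltn_trans (rank_leq_row _)).
have j'V0 : ~~ ((col j' C')^T <= V)%MS.
  by apply: contra j'V => j'V; rewrite (submx_trans j'V) ?addsmxSl.
have card_Q : (1 < #|Q|)%N.
  apply/card_gt1P; exists (g' j), (g' j'); split.
  - by rewrite imset_f ?O'E.
  - by rewrite imset_f ?O'E.
  apply/eqP => /setP/(_ j').
  by rewrite !inE addsmxSr (negPf j'V).
set a := (R + #|cols_in C' V| - (R' + #|cols_in C V|))%N in classes.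
have le_sum : (#|O'| + #|Q| * a <= #|O|)%N.
  apply: leq_trans sum_O; rewrite sum_O' -sum_nat_const -big_split /=.
  by apply: leq_sum => q /imsetP[l lO' ->]; apply: classes.
(* Here [a] equals [#|O| - #|O'|] and is positive, so [#|O'| + 2 * a] exceeds [#|O|]. *)
have le_2a : (2 * a <= #|Q| * a)%N by rewrite leq_mul2r card_Q orbT.
have cardO := cardsC (cols_in C V); have cardO' := cardsC (cols_in C' V).
rewrite !card_ord -/O -/O' in cardO cardO'.
rewrite /a in le_sum le_2a; lia.
Qed.

Lemma rank_C'_gt1 : (1 < \rank C')%N.
Proof.
apply: leq_trans rank_gt1 _.
by rewrite -(mxrank_tr C) -(mxrank_tr C') mxrankS ?cols_sub.
Qed.

(** The line of column [j] holds at most one column of [C] and at least one of [C']; with [R' <= R]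
    the flat inequality then becomes an equality throughout. *)
Lemma cols_in_flat1 j :
  R' = R /\ exists i, cols_in C (flat [set j]) = [set i] /\
    cols_in C' (flat [set j]) = [set j].
Proof.
have flat1 : (flat [set j] :=: (col j C')^T)%MS.
  by rewrite /flat big_set1; apply: genmxE.
have rk1 : \rank (flat [set j]) = 1%N.
  apply/eqP; rewrite flat1 mxrank_tr.
  by rewrite eqn_leq rank_leq_col lt0n mxrank_eq0 C'_neq0.
have := @card_cols_in_flat (\rank C' - 2) [set j].
rewrite rk1; have := rank_C'_gt1 => gt1 /(_ ltac:(lia)).
have jC' : j \in cols_in C' (flat [set j]) by rewrite inE mem_flat ?set11.
have leC : (#|cols_in C (flat [set j])| <= 1)%N.
  rewrite leqNgt; apply/negP => /card_gt1P[i1 [i2 [i1C i2C]]].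
  rewrite !inE !flat1 in i1C i2C.
  by rewrite (cols_indep i1C i2C) eqxx.
have geC' : (1 <= #|cols_in C' (flat [set j])|)%N by rewrite (cardD1 j) jC'.
move=> le_c.
have [eR /eqP cC /eqP cC'] : [/\ R' = R, #|cols_in C (flat [set j])| = 1
    & #|cols_in C' (flat [set j])| = 1]%N.
  by split; lia.
split=> //; have [i eC] := cards1P cC; exists i; split=> //.
by have [j' eC'] := cards1P cC'; move: jC'; rewrite eC' => /set1P->.
Qed.

Lemma kruskal_permutation :
  R' = R /\ exists2 s : 'I_R' -> 'I_R, injective s &
    forall j, exists2 l : F, l != 0 & col j C' = l *: col (s j) C.
Proof.
split.
  (* A line is available only if [C'] has a column; [R' = 0] would contradict [rank_C'_gt1]. *)
  have [R'0|/leq_trans] := leqP R' 0; last first.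
    move/(_ R' (leqnn _)) => gt0; by have [] := cols_in_flat1 (Ordinal gt0).
  by have := rank_C'_gt1; have := rank_leq_col C'; lia.
have [s sP] := fin_all_exists (fun j => proj2 (cols_in_flat1 j)).
have scal j : exists2 l : F, l != 0 & col j C' = l *: col (s j) C.
  have [eC _] := sP j.
  have : s j \in cols_in C (flat [set j]) by rewrite eC set11.
  rewrite inE /flat big_set1 genmxE => /sub_rVP[a ea].
  have {}ea : col (s j) C = a *: col j C'.
    by apply: trmx_inj; rewrite ea linearZ.
  have a_neq0 : a != 0.
    by apply: contra (C_neq0 (s j)) => /eqP a0; rewrite ea a0 scale0r.
  by exists a^-1; rewrite ?invr_eq0 // ea scalerA mulVf // scale1r.
exists s => // j1 j2 es.
have [l1 nz1 e1] := scal j1; have [l2 nz2 e2] := scal j2.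
have [_ eC'] := sP j2; apply/set1P; rewrite -eC' inE.
rewrite e1 es; have -> : col (s j2) C = l2^-1 *: col j2 C'.
  by rewrite e2 scalerA mulVf // scale1r.
by rewrite scalerA linearZ /= scalemx_sub // mem_flat ?set11.
Qed.

End PermutationLemma.

(** * Uniqueness when the third factor is fixed *)

Lemma krank_le (F : fieldType) (p n : nat) (M : 'M[F]_(p, n)) :
  (krank M <= n)%N.
Proof. by apply/bigmax_leqP => k _; rewrite -ltnS. Qed.

(** * Independence and dual functionals from the k-rank *)

Section KRank.
Variables (F : fieldType) (p n : nat) (M : 'M[F]_(p, n)) (S : {set 'I_n}).
Hypothesis le_S : (#|S| <= krank M)%N.

(** The k-rank speaks only of sets of exactly that size, so a smaller [S] is first enlarged. *)
Lemma krank_free : exists2 U : {set 'I_n},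
  S \subset U & free [seq col j M | j <- enum U].
Proof.
pose P (k : 'I_n.+1) :=
  [forall S : {set 'I_n}, (#|S| == k) ==> free [seq col j M | j <- enum S]].
have P0 : (0 < #|P|)%N.
  apply/card_gt0P; exists ord0; apply/forallP => U; apply/implyP.
  by rewrite cards_eq0 => /eqP->; rewrite enum_set0 nil_free.
have [k /forallP Pk eq_k] := @eq_bigmax_cond _ P (@nat_of_ord _) P0.
have {}eq_k : krank M = k by rewrite -eq_k.
have [|U US cardU] := @subset_of_card _ (~: S) (k - #|S|).
  by rewrite [#|~: _|]cardsCs setCK card_ord leq_sub2r // -ltnS.
exists (S :|: U); first exact: subsetUl.
have /implyP := Pk (S :|: U); apply; rewrite cardsU cardU.
have -> : S :&: U = set0.
  by apply/eqP; rewrite setI_eq0 disjoint_sym disjoints_subset.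
by rewrite cards0 subn0 subnKC // -eq_k.
Qed.

Lemma krank_indep (d : 'I_n -> F) :
  \sum_(j in S) d j *: col j M = 0 -> {in S, forall j, d j = 0}.
Proof.
have [U /subsetP SU freeU] := krank_free.
move=> sum0 j jS; pose e j := if j \in S then d j else 0.
suff : e j = 0 by rewrite /e jS.
have sum_e : \sum_(i <- enum U) e i *: col i M = 0.
  rewrite big_enum (bigID (mem S)) /= [X in _ + X]big1 ?addr0 => [|i];
    last first.
    by case/andP=> _ /negPf iS; rewrite /e iS scale0r.
  rewrite -[RHS]sum0; apply: eq_big => [i | i /andP[_ iS]];
    last by rewrite /e iS.
  by rewrite andb_idl // => /SU.
pose t := in_tuple (enum U).
have /freeP free_t : free (map_tuple (fun j => col j M) t) by [].
have /tnthP[i ->] : j \in t by rewrite mem_enum SU.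
apply: (free_t (fun i => e (tnth t i))).
rewrite -[RHS]sum_e [RHS]big_tnth; apply: eq_bigr => l _.
by rewrite -tnth_nth tnth_map.
Qed.

(** The columns indexed by [S] form a matrix of full rank; a column of a right inverse of its
    transpose is the dual functional. *)
Lemma krank_dual (r : 'I_n) : r \in S ->
  exists x : 'rV[F]_p, {in S, forall s, (x *m M) 0 s = (s == r)%:R}.
Proof.
move=> rS; pose N := (colsub (@enum_val _ (mem S)) M)^T.
have /row_freeP[B NB] : row_free N.
  apply: inj_row_free => v vN; apply/rowP => i; rewrite mxE.
  pose d s := v 0 (enum_rank_in rS s).
  have <- : d (enum_val i) = v 0 i by rewrite /d enum_valK_in.
  apply: (krank_indep (d := d)); last exact: enum_valP.
  rewrite big_enum_val /= -[RHS]trmx0 -vN; apply/colP => k.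
  rewrite trmx_mul trmxK summxE !mxE; apply: eq_bigr => j _.
  by rewrite /d enum_valK_in !mxE mulrC.
exists (col (enum_rank_in rS r) B)^T => s sS.
have /matrixP/(_ (enum_rank_in rS s) (enum_rank_in rS r)) := NB.
rewrite !mxE (can_in_eq (enum_rankK_in rS)) // => <-.
by apply: eq_bigr => i _; rewrite !mxE enum_rankK_in // mulrC.
Qed.

End KRank.

Lemma mxrank_diag (F : fieldType) (n : nat) (d : 'rV[F]_n) :
  \rank (diag_mx d) = #|supp d|.
Proof.
apply/eqP; rewrite eqn_leq mxrank_diag_le /=.
pose e := @enum_val _ (mem (supp d)).
apply: leq_trans (mxrank_mxsub e e _).
have -> : mxsub e e (diag_mx d) = diag_mx (colsub e d).
  by apply/matrixP => i j; rewrite !mxE (inj_eq enum_val_inj).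
rewrite mxrank_unit // unitmxE unitfE det_diag prodf_seq_neq0.
by apply/allP => i _; rewrite mxE; have := enum_valP i; rewrite inE.
Qed.

(** Functionals dual to the columns in the support recover [diag_mx d] from the weighted product by
    multiplication on both sides. *)
Lemma rank_weighted_krank (F : fieldType) (I J R : nat) (A : 'M[F]_(I, R))
    (B : 'M[F]_(J, R)) (d : 'rV[F]_R) :
    (#|supp d| <= krank A)%N -> (#|supp d| <= krank B)%N ->
  (#|supp d| <= \rank (A *m diag_mx d *m B^T))%N.
Proof.
have dual p (M : 'M[F]_(p, R)) : (#|supp d| <= krank M)%N ->
    exists X : 'M[F]_(R, p), forall r s, s \in supp d ->
      (X *m M) r s = ((r \in supp d) && (s == r))%:R.
  move=> le_M.
  have [f fP] : exists f : 'I_R -> 'rV[F]_p, forall r s, s \in supp d ->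
      (f r *m M) 0 s = ((r \in supp d) && (s == r))%:R.
    apply: (fin_all_exists (P := fun r (x : 'rV[F]_p) =>
      forall s, s \in supp d -> (x *m M) 0 s = ((r \in supp d) && (s == r))%:R)) => r.
    have [/(krank_dual le_M) // | _] := boolP (r \in supp d).
    by exists 0 => s _; rewrite mul0mx mxE.
  exists (\matrix_(r, k) f r 0 k) => r s /(fP r) <-.
  by rewrite !mxE; apply: eq_bigr => k _; rewrite !mxE.
move=> /dual[X XP] /dual[Y YP]; rewrite -[leqLHS]mxrank_diag.
have {1}-> : diag_mx d = X *m (A *m diag_mx d *m B^T) *m Y^T.
  rewrite !mulmxA -[_ *m B^T *m _]mulmxA -trmx_mul mul_mx_diag.
  apply/matrixP => p q; rewrite !mxE.
  under eq_bigr => s _ do rewrite mxE [(Y *m B)^T s q]mxE.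
  have drop s : s \notin supp d -> d 0 s = 0.
    by rewrite inE negbK => /eqP.
  have [pS | /[dup] pS /drop dp] := boolP (p \in supp d); last first.
    rewrite dp mul0rn big1 // => s _.
    have [sS | /drop->] := boolP (s \in supp d); last by rewrite mulr0 mul0r.
    by rewrite XP // (negPf pS) !mul0r.
  rewrite (bigD1 p) //= XP // YP // pS eqxx mul1r big1 ?addr0 => [|s sp].
    case: (eqVneq p q) => [<-|]; first by rewrite pS mulr1.
    by rewrite andbF mulr0.
  have [sS | /drop->] := boolP (s \in supp d); last by rewrite mulr0 mul0r.
  by rewrite XP // (negPf sp) andbF !mul0r.
by apply: leq_trans (mxrankM_maxl _ _) _; apply: mxrankM_maxr.
Qed.

(** * Collinearity of the first two factors *)

Section FixedThirdFactor.
Variables (F : fieldType) (I J K R : nat).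
Variables (A A' : 'M[F]_(I, R)) (B B' : 'M[F]_(J, R)) (C : 'M[F]_(K, R)).
Hypothesis slices : forall x : 'rV[F]_K,
  A *m diag_mx (x *m C) *m B^T = A' *m diag_mx (x *m C) *m B'^T.
Hypothesis A_neq0 : nonzero_cols A.
Hypothesis kC_gt0 : (0 < krank C)%N.
Hypothesis kA_ge : (R - krank C + 1 <= krank A)%N.
Hypothesis kB_ge : (R - krank C + 2 <= krank B)%N.

(** The complement of [Q] together with [r] has exactly [krank C] elements; the functional dual to
    [r] on it serves. *)
Lemma exists_slice (r : 'I_R) (Q : {set 'I_R}) :
    r \in Q -> #|Q| = (R - krank C + 1)%N ->
  exists x : 'rV[F]_K, (x *m C) 0 r = 1 /\ supp (x *m C) \subset Q.
Proof.
move=> rQ cardQ; have rS : r \in r |: ~: Q by rewrite setU11.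
have [|x xP] := @krank_dual _ _ _ C _ _ r rS.
  rewrite cardsU1 inE rQ /= [#|~: _|]cardsCs setCK card_ord cardQ.
  have := krank_le C; lia.
exists x; split; first by rewrite xP // eqxx.
apply/subsetP => s; rewrite inE; apply: contraR => sQ.
rewrite xP; first by have [er|//] := eqVneq s r; rewrite er rQ in sQ.
by rewrite !inE sQ orbT.
Qed.

(* The slice of a functional [x] supported on [Q] has rank [#|supp (x *m C)|],
   so the columns of [B'] in the support span the same space as those of [B]. *)
Lemma second_factor_in_span (r : 'I_R) (Q : {set 'I_R}) :
    r \in Q -> #|Q| = (R - krank C + 1)%N ->
  exists c : 'I_R -> F, (forall i, i \notin Q -> c i = 0) /\
    col r B' = \sum_i c i *: col i B.
Proof.
move=> rQ cardQ; have [x []] := exists_slice rQ cardQ.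
move: (x *m C) (slices x) => d slice_d dr /subsetP suppQ.
have le_supp : (#|supp d| <= R - krank C + 1)%N.
  by rewrite -cardQ subset_leq_card //; apply/subsetP.
pose W := diag_mx d *m B^T; pose W' := diag_mx d *m B'^T.
pose M := A *m diag_mx d *m B^T.
have MW : (M <= W)%MS by rewrite /M -mulmxA submxMl.
have MW' : (M <= W')%MS by rewrite /M slice_d -mulmxA submxMl.
have W'M : (W' <= M)%MS.
  rewrite -(geq_leqif (mxrank_leqif_sup MW')).
  apply: leq_trans (rank_weighted_krank _ _).
  - by rewrite -(mxrank_diag d) mxrankM_maxl.
  - exact: leq_trans le_supp kA_ge.
  - by apply: leq_trans le_supp (leq_trans _ kB_ge); rewrite leq_add2l.
have /submxP[u eu] : ((col r B')^T <= W)%MS.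
  apply: submx_trans (submx_trans W'M MW).
  have -> : (col r B')^T = row r W'.
    by apply/rowP => j; rewrite /W' mul_diag_mx !mxE dr mul1r.
  exact: row_sub.
exists (fun i => u 0 i * d 0 i); split=> [i iQ|].
  suff -> : d 0 i = 0 by rewrite mulr0.
  by apply: contraNeq iQ => di; rewrite suppQ // inE.
apply: trmx_inj; rewrite eu; apply/rowP => j; rewrite mxE [RHS]mxE summxE.
by apply: eq_bigr => i _; rewrite /W mul_diag_mx !mxE mulrA.
Qed.

(* Intersecting the spans over all [Q] of the form [U :\ s], where [U] is a
   fixed independent set of columns of [B], isolates the column [r]. *)
Lemma second_factor_collinear (r : 'I_R) :
  exists b : F, col r B' = b *: col r B.
Proof.
have [|U0 U0r cardU0] := @subset_of_card _ (~: [set r]) (R - krank C + 1)%N.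
  rewrite [#|~: _|]cardsCs setCK card_ord cards1.
  have := krank_le C; have := krank_le B; lia.
pose U := r |: U0; have rU0 : r \notin U0.
  by apply/negP => /(subsetP U0r); rewrite !inE eqxx.
have cardU : #|U| = (R - krank C + 2)%N by rewrite cardsU1 rU0 cardU0; lia.
have span s : s \in U0 -> exists c : 'I_R -> F,
    (forall i, i \notin U :\ s -> c i = 0) /\ col r B' = \sum_i c i *: col i B.
  move=> sU0; apply: second_factor_in_span.
    by rewrite !inE eqxx andbT; apply: contraNneq rU0 => ->.
  have := cardsD1 s U.
  by rewrite cardU in_setU1 sU0 orbT add1n addn2 addn1 => -[].
have /card_gt0P[s0 s0U0] : (0 < #|U0|)%N by rewrite cardU0 addn1.
have [c [c0 cE]] := span s0 s0U0; exists (c r).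
rewrite cE (bigD1 r) //= big1 ?addr0 // => s sr.
have [sU0 | sU0] := boolP (s \in U0); last first.
  by rewrite c0 ?scale0r // !inE (negPf sr) (negPf sU0) andbF.
(* Both expansions of [col r B'] live on the independent set [U], so they agree; the second one
   omits [s]. *)
have [e [e0 eE]] := span s sU0.
suff /eqP : c s - e s = 0.
  by rewrite [e s]e0 ?subr0 => [/eqP->|]; rewrite ?scale0r // !inE eqxx.
apply: (@krank_indep _ _ _ B U _ (fun i => c i - e i));
  last by rewrite in_setU1 sU0 orbT.
  by rewrite cardU.
transitivity (\sum_i (c i - e i) *: col i B).
  rewrite [RHS](bigID (mem U)) /= [X in _ + X]big1 ?addr0 // => i iU.
  by rewrite c0 ?e0 ?subrr ?scale0r // in_setD1 (negPf iU) andbF.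
by under eq_bigr do rewrite scalerBl; rewrite sumrB -cE -eE subrr.
Qed.

(** After substituting [B' = B *m diag_mx b] in a slice supported on [Q], a functional dual to
    column [r] of [B] on [Q] isolates [col r A = b r *: col r A']. As this column is nonzero, so is
    [b r]. *)
Lemma fixed_third_factor : exists b : 'I_R -> F, forall r,
  [/\ b r != 0, col r B' = b r *: col r B & col r A' = (b r)^-1 *: col r A].
Proof.
have [b bP] := fin_all_exists second_factor_collinear; exists b => r.
have B'E : B' = B *m diag_mx (\row_i b i).
  apply/matrixP => j i; have /colP/(_ j) := bP i.
  by rewrite mul_mx_diag !mxE mulrC.
have [Q /subsetP/(_ r (set11 r)) rQ cardQ] :
  exists2 Q : {set 'I_R}, [set r] \subset Q & #|Q| = (R - krank C + 1)%N.
- have [|U Ur cardU] := @subset_of_card _ (~: [set r]) (R - krank C)%N.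
    rewrite [#|~: _|]cardsCs setCK card_ord cards1.
    have := krank_le C; have := krank_le B; lia.
  exists (r |: U); first by rewrite subsetUl.
  rewrite cardsU1 cardU.
  case: (boolP (r \in U)) => [/(subsetP Ur)|_]; last by lia.
  by rewrite !inE eqxx.
have [x [xr /subsetP suppQ]] := exists_slice rQ cardQ.
have [|y yP] := @krank_dual _ _ _ B Q _ r rQ.
  by rewrite cardQ (leq_trans _ kB_ge) // leq_add2l.
have yBd : diag_mx (x *m C) *m (B^T *m y^T) = delta_mx r 0.
  rewrite -trmx_mul mul_diag_mx; apply/matrixP => i j.
  rewrite ord1 !mxE eqxx andbT.
  have [iQ|iQ] := boolP (i \in Q).
    have := yP i iQ; rewrite !mxE => ->.
    by case: eqVneq => [->|]; rewrite ?mulr1 ?mulr0 // -[RHS]xr mxE.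
  have : (x *m C) 0 i = 0 by apply: contraNeq iQ => ?; rewrite suppQ // inE.
  rewrite mxE => ->; rewrite mul0r; case: eqVneq => // ir.
  by rewrite ir rQ in iQ.
have := congr1 (mulmx^~ y^T) (slices x) => /=.
rewrite B'E trmx_mul tr_diag_mx.
rewrite -!mulmxA yBd [diag_mx (x *m C) *m _]mulmxA diag_mxC -mulmxA yBd -colE.
move=> eA.
have {}eA : col r A = b r *: col r A'.
  rewrite eA mulmxA -colE mul_mx_diag; apply/colP => i.
  by rewrite !mxE mulrC.
have br : b r != 0.
  by apply: contra (A_neq0 r) => /eqP b0; rewrite eA b0 scale0r.
split=> //; first by rewrite -B'E bP.
by rewrite eA scalerA mulVf // scale1r.
Qed.

End FixedThirdFactor.

(** * Uniqueness of the decomposition *)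

Definition cpd_equiv (F : fieldType) (I J K n : nat)
    (A A' : 'M[F]_(I, n)) (B B' : 'M[F]_(J, n)) (C C' : 'M[F]_(K, n)) : Prop :=
  exists (s : 'S_n) (la lb lc : 'I_n -> F), forall j,
    [/\ col j A' = la j *: col (s j) A, col j B' = lb j *: col (s j) B,
        col j C' = lc j *: col (s j) C & la j * lb j * lc j = 1].

(** Allows two arbitrary decompositions to be compared through a fixed third one; the scalars can be
    divided since their product is 1. *)
Lemma cpd_equiv_comparable (F : fieldType) (I J K n : nat)
    (A A1 A2 : 'M[F]_(I, n)) (B B1 B2 : 'M[F]_(J, n)) (C C1 C2 : 'M[F]_(K, n)) :
  cpd_equiv A A1 B B1 C C1 -> cpd_equiv A A2 B B2 C C2 ->
  cpd_equiv A1 A2 B1 B2 C1 C2.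
Proof.
move=> [s1 [la1 [lb1 [lc1 e1]]]] [s2 [la2 [lb2 [lc2 e2]]]].
pose s := (s2 * s1^-1)%g; exists s.
exists (fun j => la2 j / la1 (s j)), (fun j => lb2 j / lb1 (s j)),
  (fun j => lc2 j / lc1 (s j)) => j.
have sE : s1 (s j) = s2 j by rewrite permM permKV.
have [eA1 eB1 eC1 el1] := e1 (s j); have [eA2 eB2 eC2 el2] := e2 j.
have : la1 (s j) * lb1 (s j) * lc1 (s j) != 0 by rewrite el1 oner_eq0.
rewrite !mulf_eq0 !negb_or -andbA => /and3P[nzA nzB nzC].
rewrite sE in eA1 eB1 eC1.
split; rewrite ?eA1 ?eB1 ?eC1 ?scalerA ?divfK //.
by rewrite mulf_div mulf_div el1 el2 divr1.
Qed.

Lemma cpd_equiv_mx (F : fieldType) (I J K n : nat)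
    (A A' : 'M[F]_(I, n)) (B B' : 'M[F]_(J, n)) (C C' : 'M[F]_(K, n)) :
  cpd_equiv A A' B B' C C' ->
  exists P LA LB LC : 'M[F]_n,
      [/\ is_perm_mx P,
          [/\ nonsingular_diag LA, nonsingular_diag LB & nonsingular_diag LC],
          [/\ A' = A *m P *m LA, B' = B *m P *m LB & C' = C *m P *m LC]
        & LA *m LB *m LC = 1%:M].
Proof.
move=> [s [la [lb [lc e]]]]; pose D (l : 'I_n -> F) := diag_mx (\row_j l j).
(* Column [j] of [A *m perm_mx s^-1] is column [s j] of [A], hence the inverse. *)
exists (perm_mx s^-1), (D la), (D lb), (D lc).
have el j : la j * lb j * lc j = 1 by have [] := e j.
have nz j : [/\ la j != 0, lb j != 0 & lc j != 0].
  apply/and3P; have : la j * lb j * lc j != 0 by rewrite el oner_eq0.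
  by rewrite !mulf_eq0 !negb_or -andbA.
have nonsing l : (forall j, l j != 0) -> nonsingular_diag (D l).
  move=> l_neq0; rewrite /nonsingular_diag diag_mx_is_diag unitmxE unitfE.
  by rewrite det_diag prodf_seq_neq0; apply/allP => j _; rewrite mxE l_neq0.
have factor p (M M' : 'M[F]_(p, n)) l :
    (forall j, col j M' = l j *: col (s j) M) -> M' = M *m perm_mx s^-1 *m D l.
  move=> eM; rewrite -col_permE mul_mx_diag; apply/matrixP => i j.
  by have /colP/(_ i) := eM j; rewrite !mxE mulrC.
split; first exact: perm_mx_is_perm.
- by split; apply: nonsing => j; have [] := nz j.
- by split; apply: factor => j; have [] := e j.
rewrite !mulmx_diag -diag_const_mx; congr diag_mx.
by apply/rowP => j; rewrite !mxE.
Qed.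

(** The right side depends on [T] alone, so all decompositions share their slices. *)
Lemma decomp_slices (F : fieldType) (I J K n : nat) (T : tensor F I J K)
    (A : 'M[F]_(I, n)) (B : 'M[F]_(J, n)) (C : 'M[F]_(K, n)) (x : 'rV[F]_K) :
    is_decomp T A B C ->
  A *m diag_mx (x *m C) *m B^T = \matrix_(i, j) \sum_k x 0 k * T (i, j, k).
Proof.
case=> _ _ _ ->; apply/matrixP => i j; rewrite mul_mx_diag !mxE.
under [RHS]eq_bigr => k _ do rewrite sum_ffunE mulr_sumr.
rewrite exchange_big; apply: eq_bigr => r _.
rewrite !mxE mulr_sumr mulr_suml; apply: eq_bigr => k _.
by rewrite ffunE !mxE /=; ring.
Qed.

(** * From equal slices to equivalent decompositions *)

Section ThirdFactor.
Variables (F : fieldType) (I J K R : nat) (T : tensor F I J K).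
Variables (A : 'M[F]_(I, R)) (B : 'M[F]_(J, R)) (C : 'M[F]_(K, R)).
Hypothesis T_decomp : is_decomp T A B C.
Hypothesis rank_ge : forall d : 'rV[F]_R,
  (minn #|supp d| (R - \rank C + 2) <= \rank (A *m diag_mx d *m B^T))%N.
Hypothesis rankC : (1 < \rank C)%N.
Hypothesis kC : (1 < krank C)%N.

Lemma third_factor_unique (R' : nat) (A' : 'M[F]_(I, R')) (B' : 'M[F]_(J, R'))
    (C' : 'M[F]_(K, R')) : (R' <= R)%N -> is_decomp T A' B' C' ->
  R' = R /\ exists2 s : 'I_R' -> 'I_R, injective s &
    forall j, exists2 l : F, l != 0 & col j C' = l *: col (s j) C.
Proof.
move=> le_R'R decomp'; have [_ _ C_neq0 _] := T_decomp.
have [_ _ C'_neq0 _] := decomp'.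
apply: kruskal_permutation => //.
  move=> v i1 i2 /sub_rVP[a1 e1] /sub_rVP[a2 e2].
  have [//|ne_i12] := eqVneq i1 i2.
  have a_neq0 i a : (col i C)^T = a *: v -> a != 0.
    move=> e; apply: contra (C_neq0 i) => /eqP a0.
    by apply/eqP/trmx_inj; rewrite e a0 scale0r trmx0.
  (* Two columns [a1 *: v] and [a2 *: v] satisfy this relation, which [krank C > 1] forbids. *)
  pose d j := if j == i1 then a2 else - a1.
  have := @krank_indep _ _ _ C [set i1; i2] _ d.
  rewrite cards2 ne_i12 => /(_ kC) indep.
  have /indep/(_ i1) : \sum_(j in [set i1; i2]) d j *: col j C = 0.
    rewrite big_setU1 ?inE //= big_set1 /d eqxx eq_sym (negPf ne_i12).
    apply: trmx_inj; rewrite linearD !linearZ /= e1 e2 !scalerA trmx0.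
    by rewrite -scalerDl mulNr mulrC subrr scale0r.
  rewrite !inE eqxx /d eqxx => /(_ isT) a20.
  by have := a_neq0 _ _ e2; rewrite a20 eqxx.
move=> x; apply: leq_trans (rank_ge _) _.
rewrite (decomp_slices x T_decomp) -(decomp_slices x decomp').
apply: leq_trans (mxrank_diag_le _).
by apply: leq_trans (mxrankM_maxl _ _) _; apply: mxrankM_maxr.
Qed.

Hypothesis cond_i : (R + 1 <= maxn (minn (krank A) (krank B - 1))
                                   (minn (krank A - 1) (krank B)) + krank C)%N.

Lemma decomp_equiv (A' : 'M[F]_(I, R)) (B' : 'M[F]_(J, R)) (C' : 'M[F]_(K, R)) :
  is_decomp T A' B' C' -> cpd_equiv A A' B B' C C'.
Proof.
move=> decomp'; have [A_neq0 B_neq0 _ _] := T_decomp.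
have [_ [s inj_s scal]] := third_factor_unique (leqnn R) decomp'.
have [lc lcP] : exists lc : 'I_R -> F, forall j,
    lc j != 0 /\ col j C' = lc j *: col (s j) C.
  by apply: (fin_all_exists (P := fun j (l : F) =>
    l != 0 /\ col j C' = l *: col (s j) C)) => j; have [l] := scal j; exists l.
pose p := perm inj_s; pose q := (p^-1)%g.
(* Reordering the columns and moving the scalars [lc] into the first factor makes the third factor
   equal to [C]. *)
pose A1 := colsub q (A' *m diag_mx (\row_j lc j)); pose B1 := colsub q B'.
have A1E i r : A1 i r = A' i (q r) * lc (q r).
  by rewrite /A1 mul_mx_diag !mxE.
have slices (x : 'rV[F]_K) :
    A *m diag_mx (x *m C) *m B^T = A1 *m diag_mx (x *m C) *m B1^T.
  rewrite (decomp_slices x T_decomp) -(decomp_slices x decomp').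
  apply/matrixP => i j; rewrite !mul_mx_diag [LHS]mxE [RHS]mxE.
  rewrite (reindex_inj (@perm_inj _ q)); apply: eq_bigr => r _.
  rewrite [in RHS]mxE A1E [LHS]mulrC [RHS]mulrC !mxE; congr (_ * _).
  rewrite -mulrA; congr (_ * _).
  have [_ /colP eC'] := lcP (q r).
  rewrite mulr_sumr; apply: eq_bigr => k _; have := eC' k.
  by rewrite !mxE -[s _](permE inj_s) permKV => ->; ring.
have kC_le := krank_le C.
have [a [b abP]] : exists a b : 'I_R -> F, forall r,
    [/\ col r A1 = a r *: col r A, col r B1 = b r *: col r B & a r * b r = 1].
  (* The maximum in [cond_i] decides which of [A] and [B] has the larger k-rank bound; transposing
     the slices exchanges their roles. *)
  case: (leqP (R + 1) (minn (krank A) (krank B - 1) + krank C)) => [le1 | lt1].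
    have [||b bP] := fixed_third_factor slices A_neq0 (ltnW kC).
    - lia.
    - lia.
    exists (fun r => (b r)^-1), b => r; have [nz eB eA] := bP r.
    by rewrite mulVf.
  have slicesT (x : 'rV[F]_K) :
      B *m diag_mx (x *m C) *m A^T = B1 *m diag_mx (x *m C) *m A1^T.
    by apply: trmx_inj; rewrite !trmx_mul !trmxK !tr_diag_mx !mulmxA.
  have [||a aP] := fixed_third_factor slicesT B_neq0 (ltnW kC).
  - lia.
  - lia.
  by exists a, (fun r => (a r)^-1) => r; have [nz eA eB] := aP r; rewrite mulfV.
exists p, (fun j => a (p j) / lc j), (fun j => b (p j)), lc => j.
have [nz eC] := lcP j; have [eA eB ab] := abP (p j).
split.
- have : col (p j) A1 = lc j *: col j A'.
    by apply/colP => i; rewrite mxE A1E !mxE permK mulrC.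
  by rewrite eA => e; rewrite mulrC -scalerA e scalerA mulVf // scale1r.
- rewrite -eB; apply/colP => i; by rewrite !mxE permK.
- by rewrite eC permE.
by rewrite mulrAC divfK.
Qed.

End ThirdFactor.

Theorem corollary1p25
  (RR : realType) (F : fieldType)
  (F_real_or_complex : F = RR :> fieldType \/ F = RR[i] :> fieldType)
  (I J K R : nat)
  (A : 'M[F]_(I, R)) (B : 'M[F]_(J, R)) (C : 'M[F]_(K, R))
  (T : tensor F I J K) (T_decomp : is_decomp T A B C)
  (m : nat) (m_def : m = (R - \rank C + 2)%N)
  (cond_i : (R + 1 <= maxn (minn (krank A) (krank B - 1))
                           (minn (krank A - 1) (krank B)) + krank C)%N)
  (compound_A_defined : (m <= minn I R)%N)
  (compound_B_defined : (m <= minn J R)%N)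
  (cond_ii : \rank (khatri_rao (compound m A) (compound m B)) = 'C(R, m)) :
  tensor_rank T = R /\ cpd_unique T.
Proof.
have le_mR : (m <= R)%N by rewrite (leq_trans compound_A_defined) ?geq_minr.
have rank_ge (d : 'rV[F]_R) := rank_weighted_ge cond_ii d le_mR.
rewrite m_def in rank_ge le_mR.
(* The compound matrices are defined, so [R - \rank C + 2 <= R]. *)
have rankC : (1 < \rank C)%N by have := rank_leq_col C; lia.
(* The maximum in [cond_i] is at most [R - 1], as k-ranks are at most [R]. *)
have kC : (1 < krank C)%N.
  by have := krank_le A; have := krank_le B; lia.
have rankT : tensor_rank T = R.
  rewrite /tensor_rank; case: ex_minnP => n /asboolP[A' [B' [C' decomp']]] min_n.
  have le_nR : (n <= R)%N by apply: min_n; apply/asboolP; exists A, B, C.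
  by have [] := third_factor_unique T_decomp rank_ge rankC kC le_nR decomp'.
split=> //; rewrite /cpd_unique /=.
(* Eliminating the equality turns the column count [tensor_rank T] in the matrix types into [R]. *)
case: _ / (esym rankT) => A1 A2 B1 B2 C1 C2 d1 d2.
by apply/cpd_equiv_mx/cpd_equiv_comparable; apply: (decomp_equiv T_decomp).
Qed.
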